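(* Let $\{M(t)\}$ be a generalized counting process with positive rates $\lambda_1,\dots,\lambda_k$, $\Lambda=\lambda_1+\cdots+\lambda_k$, let $\gamma>0$, and let $R(t)=(X_\gamma(t))^2$, where $\{X_\gamma(t)\}_{t\ge0}$ is a Bessel process of parameter $\gamma$ with $X_\gamma(0)=0$, independent of $\{M(t)\}$. The state probabilities $\bar p_\gamma(n,t)=\Pr\{\bar M^\gamma(t)=n\}$ of $\bar M^\gamma(t)=M(R(t))$, $t>0$, are given by $$\bar p_\gamma(n,t)=\sum_{\Omega(k,n)}\Big(\prod_{j=1}^k\frac{\lambda_j^{x_j}}{x_j!}\Big)\frac{(2t)^{z_k}\,\Gamma(z_k+\frac\gamma2)}{\Gamma(\frac\gamma2)\,(2\Lambda t+1)^{z_k+\frac\gamma2}},\qquad n\ge0,$$ where $z_k=x_1+x_2+\cdots+x_k$.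
   Context: Generalized counting process (GCP): for $k\ge1$ and $\lambda_1,\dots,\lambda_k>0$, it is the non-negative integer valued Lévy process $\{M(t)\}_{t\ge0}$, $M(0)=0$, with $\Pr\{M(t+h)=n+j\mid M(t)=n\}=1-\Lambda h+o(h)$ for $j=0$, $=\lambda_jh+o(h)$ for $1\le j\le k$, $=o(h)$ for $j\ge k+1$, where $\Lambda=\sum_{j=1}^k\lambda_j$. Equivalently $\mathbb{E}(u^{M(t)})=\exp(-t\sum_{j=1}^k\lambda_j(1-u^j))$ for $|u|\le1$. The squared Bessel process $R(t)$ has density $f^2_\gamma(s,t)=\frac{e^{-s/2t}s^{\frac\gamma2-1}}{(2t)^{\gamma/2}\Gamma(\gamma/2)}$, $s>0$, $t>0$. $\Omega(k,n)=\{(x_1,\dots,x_k)\in\mathbb{N}_0^k:\sum_{j=1}^kjx_j=n\}$, $\mathbb{N}_0$ the non-negative integers. *)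

(* Defs.v *)
From HB Require Import structures.
From mathcomp Require Import all_boot all_order all_algebra.
From mathcomp Require Import all_classical all_reals all_analysis.

Set Implicit Arguments.
Unset Strict Implicit.
Unset Printing Implicit Defensive.

Import Order.TTheory GRing.Theory Num.Theory.
Import numFieldNormedType.Exports.

Local Open Scope classical_set_scope.
Local Open Scope ring_scope.

(* Processes are indexed by R, but only the times t >= 0 are constrained or
   used.  Path properties are required for every sample point: the probability
   space need not be complete, and regularity of all paths is what makes a
   randomly time-changed process such as M(R(t)) a random variable. *)

Section processes.
Context {R : realType} {d : measure_display} {T : measurableType d}.
Variable P : probability T R.

Definition is_process (Y : R -> T -> R) :=
  forall t, 0 <= t -> measurable_fun [set: T] (Y t).

Definition process_sigma (Y : R -> T -> R) : set (set T) :=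
  <<s [set A | exists t B, [/\ 0 <= t, measurable B & A = Y t @^-1` B]] >>.

Definition independent_processes (Y Z : R -> T -> R) :=
  forall A B, process_sigma Y A -> process_sigma Z B ->
    P (A `&` B) = (P A * P B)%E.

(* Some of the B i may be the whole line, so that this contains the product
   rule for all subfamilies. *)
Definition mutually_independent (I : finType) (Y : I -> T -> R) :=
  forall B : I -> set R, (forall i, measurable (B i)) ->
    P (\bigcap_i (Y i @^-1` B i)) = (\prod_i P (Y i @^-1` B i))%E.

Definition cadlag (f : R -> R) :=
  (forall t, 0 <= t -> f s @[s --> t^'+] --> f t) /\
  (forall t, 0 < t -> cvg (f s @[s --> t^'-])).

Definition independent_increments (Y : R -> T -> R) :=
  forall (m : nat) (t : nat -> R), 0 <= t 0%N ->
    {homo t : i j / (i <= j)%N >-> i <= j} ->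
    mutually_independent (fun (i : 'I_m) w => Y (t i.+1) w - Y (t i) w).

Definition stationary_increments (Y : R -> T -> R) :=
  forall s h, 0 <= s -> 0 <= h -> forall B, measurable B ->
    P ((fun w => Y (s + h) w - Y s w) @^-1` B) = P (Y h @^-1` B).

Record levy_process (Y : R -> T -> R) : Prop := LevyProcess {
  levy_measurable : is_process Y;
  levy_start : forall w, Y 0 w = 0;
  levy_cadlag : forall w, cadlag (Y ^~ w);
  levy_independent : independent_increments Y;
  levy_stationary : stationary_increments Y }.

Definition cprob (A B : set T) : R := fine (P (A `&` B)) / fine (P B).

Definition nat_process (M : R -> T -> nat) : R -> T -> R :=
  fun t w => (M t w)%:R.

Section counting.
(* lambda j, for j = 0, ..., k - 1, is the rate of the jumps of size j + 1. *)
Variables (k : nat) (lambda : 'I_k -> R).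

Definition total_rate : R := \sum_(j < k) lambda j.

Definition jump_prob (M : R -> T -> nat) (t : R) (n j : nat) (h : R) : R :=
  cprob [set w | M (t + h) w = (n + j)%N] [set w | M t w = n].

Record gcp (M : R -> T -> nat) : Prop := Gcp {
  gcp_levy : levy_process (nat_process M);
  gcp_stay : forall t n, 0 <= t -> P [set w | M t w = n] != 0%E ->
    (fun h : R => jump_prob M t n 0 h - (1 - total_rate * h))
      =o_ (0^'+) (fun h : R => h);
  gcp_jump : forall t n, 0 <= t -> P [set w | M t w = n] != 0%E ->
    forall j : 'I_k,
    (fun h : R => jump_prob M t n j.+1 h - lambda j * h)
      =o_ (0^'+) (fun h : R => h);
  gcp_rare : forall t n, 0 <= t -> P [set w | M t w = n] != 0%E ->
    forall j : nat, (k < j)%N ->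
    (fun h : R => jump_prob M t n j h) =o_ (0^'+) (fun h : R => h) }.

End counting.

Definition Gamma (a : R) : R :=
  (\int[lebesgue_measure]_(x in `]0, +oo[) (x `^ (a - 1) * expR (- x)))%R.

(* Density in s of the squared Bessel process of parameter gamma started at 0,
   at time t. *)
Definition besq0_density (gamma s t : R) : R :=
  expR (- (s / (2 * t))) * s `^ (gamma / 2 - 1) /
  ((2 * t) `^ (gamma / 2) * Gamma (gamma / 2)).

(* Transition density of the squared Bessel process.  For x > 0, expanding the
   modified Bessel function I_nu, nu = gamma / 2 - 1, in
     (1 / 2t) (y / x)^(nu / 2) exp (- (x + y) / 2t) I_nu (sqrt (x y) / t)
   gives this Poisson mixture; for x = 0 only the term m = 0 remains and the
   value is besq0_density gamma y t. *)
Definition besq_density (gamma t x y : R) : \bar R :=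
  (\sum_(0 <= m <oo)
    (expR (- (x / (2 * t))) * (x / (2 * t)) ^+ m / m`!%:R *
     besq0_density (gamma + (2 * m)%:R) y t)%:E)%E.

(* Probability that the squared Bessel process, at position x at time s, lies
   in B u for each of the times u of the increasing list l, all later than
   s. *)
Fixpoint besq_fdd (gamma : R) (B : R -> set R) (s x : R) (l : seq R) : \bar R :=
  if l is u :: l' then
    (\int[lebesgue_measure]_(y in B u `&` `]0%R, +oo[)
       (besq_density gamma (u - s) x y * besq_fdd gamma B u y l'))%E
  else 1%E.

Record squared_bessel0 (gamma : R) (Y : R -> T -> R) : Prop := SquaredBessel0 {
  besq_measurable : is_process Y;
  besq_start : forall w, Y 0 w = 0;
  besq_fddE : forall (l : seq R) (B : R -> set R),
    path <%R 0 l -> (forall s, measurable (B s)) ->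
    P (\bigcap_(s in [set` l]) (Y s @^-1` B s)) = besq_fdd gamma B 0 0 l }.

(* Bessel process of parameter gamma started at 0: the nonnegative continuous
   process whose square is a squared Bessel process. *)
Record bessel0 (gamma : R) (X : R -> T -> R) : Prop := Bessel0 {
  bessel_measurable : is_process X;
  bessel_start : forall w, X 0 w = 0;
  bessel_ge0 : forall t w, 0 <= t -> 0 <= X t w;
  bessel_continuous : forall w, {within `[0, +oo[, continuous (X ^~ w)};
  bessel_square : squared_bessel0 gamma (fun t w => X t w ^+ 2) }.

Definition time_changed (M : R -> T -> nat) (S : R -> T -> R) : R -> T -> nat :=
  fun t w => M (S t w) w.

End processes.

Definition Omega (k n : nat) : set {ffun 'I_k -> nat} :=
  [set x | (\sum_(j < k) j.+1 * x j)%N = n].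
Arguments Omega : clear implicits.

(* Main.v *)
(** Since M has independent stationary increments, the probabilities
    q_n(s) = P(M(s) = n) form a convolution semigroup, and the infinitesimal
    rates make them solve the Kolmogorov system
      q_n' = - Lambda q_n + sum_j lambda_j q_(n-j);
    solving it by induction on n gives
      q_n(s) = exp (- Lambda s)
               sum_(x in Omega(k, n)) (prod_j lambda_j^(x_j) / x_j!) s^(z(x)).
    Next, P(M(R_t) = n) is the integral of q_n against the law of R_t:
    approximate R_t from the right by variables with values in a grid, for
    which it follows from independence, and pass to the limit using that the
    paths of M are right-continuous.  As R_t has density besq0_density,
    each composition x contributes a Gamma integral.  Its convergence needs no
    separate proof: it is a nonnegative term of a sum equal to a probability. *)

From HB Require Import structures.
Require Import Defs.
From mathcomp Require Import all_boot all_order all_algebra.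
From mathcomp Require Import all_classical all_reals all_analysis.
From mathcomp Require Import ring finmap measurable_realfun.
Import Order.TTheory GRing.Theory Num.Theory.
Import numFieldNormedType.Exports.
Local Open Scope classical_set_scope.
Local Open Scope ring_scope.

(** * Compositions of an integer *)

Section compositions.
Context {R : realType} {k : nat} (lambda : 'I_k -> R).
Implicit Types (n : nat) (x y : {ffun 'I_k -> nat}) (j : 'I_k) (t : R).

Definition weight x : R := \prod_(j < k) (lambda j ^+ x j / (x j)`!%:R).

Definition nb_jumps x : nat := (\sum_(j < k) x j)%N.

(** The polynomial that multiplies exp (- Lambda t) in the state probabilities of M. *)
Definition jump_poly n t : R :=
  \sum_(x \in Omega k n) weight x * t ^+ nb_jumps x.

Lemma Omega_mul_le n x j : Omega k n x -> (j.+1 * x j <= n)%N.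
Proof. by move=> /= <-; rewrite (bigD1 j)//= leq_addr. Qed.

Lemma Omega_le n x j : Omega k n x -> (x j <= n)%N.
Proof. by move=> /(Omega_mul_le _ _ j); apply: leq_trans; rewrite leq_pmull. Qed.

(** Every coordinate is at most [n], so [Omega k n] lies in the image of a finite type. This turns
    the sums over [Omega k n] into ordinary big sums. *)
Lemma finite_Omega n : finite_set (Omega k n).
Proof.
pose h (y : {ffun 'I_k -> 'I_n.+1}) : {ffun 'I_k -> nat} :=
  [ffun j => y j : nat].
apply: (@sub_finite_set _ _ (h @` setT)); last exact/finite_image/finite_finset.
move=> x xO; exists [ffun j => inord (x j)] => //.
by apply/ffunP => j; rewrite !ffunE inordK// ltnS (Omega_le _ _ j xO).
Qed.

Definition add_jump j x : {ffun 'I_k -> nat} :=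
  [ffun i => (x i + (i == j))%N].

Lemma weight_add_jump j x :
  (x j).+1%:R * weight (add_jump j x) = lambda j * weight x.
Proof.
rewrite /weight (bigD1 j)//= [X in _ = _ * X](bigD1 j)//= ffunE eqxx addn1.
rewrite exprS factS natrM invfM.
under eq_bigr => i ij do rewrite ffunE (negbTE ij) addn0.
rewrite !mulrA; congr (_ * _).
have ? : (x j).+1%:R != 0 :> R by rewrite pnatr_eq0.
have ? : (x j)`!%:R != 0 :> R by rewrite pnatr_eq0 -lt0n fact_gt0.
by field; apply/andP.
Qed.

Lemma nb_jumps_add_jump j x : nb_jumps (add_jump j x) = (nb_jumps x).+1.
Proof.
rewrite /nb_jumps (eq_bigr (fun i => x i + (i == j))%N) => [|i _]; last first.
  by rewrite ffunE.
rewrite big_split/= -addn1; congr (_ + _)%N.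
by rewrite (bigD1 j)//= eqxx big1 ?addn0// => i /negbTE ->.
Qed.

Lemma Omega_add_jump n j x :
  Omega k (n + j.+1) (add_jump j x) <-> Omega k n x.
Proof.
rewrite /Omega/=.
under eq_bigr do rewrite ffunE mulnDr.
rewrite big_split/= [X in (_ + X)%N = _](_ : _ = j.+1); last first.
  rewrite (bigD1 j)//= eqxx muln1 [X in (_ + X)%N]big1 ?addn0//.
  by move=> i /negbTE ->; rewrite muln0.
by split=> [/eqP|->//]; rewrite eqn_add2r => /eqP.
Qed.

(** [j < n] makes [n - j.+1] an exact subtraction; the inverse map takes one unit off coordinate
    [j]. *)
Lemma add_jump_bij n j : (j < n)%N ->
  set_bij (Omega k (n - j.+1)) (Omega k n `&` [set x : {ffun _} | x j != 0%N])
    (add_jump j).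
Proof.
move=> jn; split.
- move=> x /(Omega_add_jump (n - j.+1) j x).2; rewrite subnK// => xO; split=> //.
  by rewrite /= ffunE eqxx addn1.
- move=> x y _ _ /ffunP xy; apply/ffunP => i.
  by have /eqP := xy i; rewrite !ffunE eqn_add2r => /eqP.
- move=> x [xO /= xj]; pose y := [ffun i => (x i - (i == j))%N] : {ffun 'I_k -> nat}.
  have yx : add_jump j y = x.
    apply/ffunP => i; rewrite !ffunE; case: eqVneq => [->|_].
      by rewrite subnK// lt0n.
    by rewrite subn0 addn0.
  by exists y => //; apply/(Omega_add_jump _ j); rewrite yx subnK.
Qed.

(* As [x j * weight x = lambda j * weight (x - e_j)], only the terms with
   [x j != 0] remain, and they are indexed by the compositions of [n - (j + 1)]. *)
Lemma sum_jumps n j t :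
  \sum_(x \in Omega k n) (x j)%:R * (weight x * t ^+ (nb_jumps x).-1) =
  (if (j < n)%N then lambda j * jump_poly (n - j.+1) t else 0).
Proof.
have fO := finite_Omega n.
rewrite (fsbigID [set x : {ffun _} | x j != 0%N])//= [X in _ + X]fsbig1 ?addr0;
  last first.
  by move=> x [_ /= /negP]; rewrite negbK => /eqP ->; rewrite mul0r.
case: ltnP => [jn|nj]; last first.
  (* A jump of size [j + 1 > n] fits in no composition of [n]. *)
  apply: fsbig1 => x [/(Omega_mul_le _ _ j) xn /= xj]; exfalso.
  have := leq_trans xn nj; apply/negP.
  by rewrite -ltnNge leq_pmulr// lt0n.
rewrite (reindex_fsbig _ _ _ _ (add_jump_bij n j jn)) mulr_fsumr.
apply: eq_fsbigr => x _.
by rewrite nb_jumps_add_jump mulrA {1}ffunE eqxx addn1 weight_add_jump mulrA.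
Qed.

Lemma is_derive_bigsum (I : Type) (s : seq I) (f df : I -> R -> R) t :
  (forall i, is_derive t 1 (f i) (df i t)) ->
  is_derive t 1 (fun u => \sum_(i <- s) f i u) (\sum_(i <- s) df i t).
Proof.
move=> fd; elim: s => [|i s ih].
  rewrite big_nil (_ : (fun _ => _) = cst 0); first exact: is_derive_cst.
  by apply/funext => u; rewrite big_nil.
rewrite big_cons (_ : (fun _ => _) =
  f i + (fun u => \sum_(i <- s) f i u)); first exact: is_deriveD.
by apply/funext => u; rewrite big_cons.
Qed.

(** In the termwise derivative the factor [nb_jumps x] is the sum of the [x j]; after exchanging the
    sums, [sum_jumps] removes one jump of each size. The result is the Kolmogorov system without its
    - Lambda term. *)
Lemma is_derive_jump_poly n t :
  is_derive t 1 (jump_poly n)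
    (\sum_(j < k | (j < n)%N) lambda j * jump_poly (n - j.+1) t).
Proof.
have fO := finite_Omega n.
rewrite (_ : jump_poly n = fun u =>
    \sum_(x <- fset_set (Omega k n)) weight x * u ^+ nb_jumps x); last first.
  by apply/funext => u; rewrite /jump_poly fsbig_finite.
suff -> : \sum_(j < k | (j < n)%N) lambda j * jump_poly (n - j.+1) t =
    \sum_(x <- fset_set (Omega k n))
      weight x * ((nb_jumps x)%:R * t ^+ (nb_jumps x).-1).
  apply: (is_derive_bigsum _ _ (fun x u => weight x * u ^+ nb_jumps x)
    (fun x u => weight x * ((nb_jumps x)%:R * u ^+ (nb_jumps x).-1))) => x.
  have := is_deriveZ (weight x) (is_deriveX (nb_jumps x) (is_derive_id t 1)).
  by rewrite /GRing.scale/= mulr1 exprfctE.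
rewrite big_mkcond/=.
under eq_bigr do rewrite -sum_jumps fsbig_finite//=.
rewrite exchange_big/=; apply: eq_bigr => x _.
by rewrite -mulr_suml /nb_jumps -natr_sum mulrCA.
Qed.

Lemma jump_poly0 n : jump_poly n 0 = (n == 0%N)%:R.
Proof.
have fO := finite_Omega n.
case: eqVneq => [->|n0]; last first.
  apply: fsbig1 => x; rewrite /Omega/= => xn; rewrite expr0n.
  case: eqVneq => [|_]; last by rewrite mulr0.
  move=> /eqP; rewrite sum_nat_eq0 => /forallP/= x0; move: n0; rewrite -xn.
  by rewrite big1 ?eqxx// => j _; rewrite (eqP (x0 j)) muln0.
rewrite /jump_poly; have -> : Omega k 0 = [set [ffun=> 0%N]].
  apply/seteqP; split => x.
    by move=> xO; apply/ffunP => j; rewrite ffunE; apply/eqP;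
      rewrite -leqn0 (Omega_le _ _ j xO).
  by move=> /= ->; rewrite /Omega/= big1// => j _; rewrite ffunE muln0.
rewrite fsbig_set1 /weight /nb_jumps !big1 ?mulr1// => j _; rewrite ffunE//.
by rewrite expr0 fact0 divr1.
Qed.

End compositions.

(** * Marginals of the generalized counting process *)

Section gcp_marginals.
Context {R : realType} {d : measure_display} {T : measurableType d}.
Variables (P : probability T R) (k : nat) (lambda : 'I_k -> R).
Variables (M : R -> T -> nat) (M_gcp : gcp P lambda M).
Implicit Types (n j : nat) (s t h : R).

Definition state_prob n t : R := fine (P [set w | M t w = n]).

Let M_levy := gcp_levy M_gcp.

Lemma nat_process_preimage n t :
  [set w | M t w = n] = nat_process M t @^-1` [set n%:R].
Proof.
apply/seteqP; split=> w /=; rewrite /nat_process; first by move=> ->.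
by move=> /eqP; rewrite eqr_nat => /eqP.
Qed.

Lemma measurable_nat_process t B : 0 <= t -> measurable B ->
  measurable (nat_process M t @^-1` B).
Proof.
move=> t0 mB; rewrite -[X in measurable X]setTI.
exact: (levy_measurable M_levy).
Qed.

Lemma measurable_state n t : 0 <= t -> measurable [set w | M t w = n].
Proof. by move=> t0; rewrite nat_process_preimage; exact: measurable_nat_process. Qed.

Lemma M0 w : M 0 w = 0%N.
Proof.
by have /eqP := levy_start M_levy w; rewrite /nat_process pnatr_eq0 => /eqP.
Qed.

(** Independence of increments at times 0, [s], [s + h]: as M(0) = 0 the first increment is M(s),
    and by stationarity the second has the law of M(h). *)
Lemma nat_process_increment s h (A B : set R) : 0 <= s -> 0 <= h ->
  measurable A -> measurable B ->
  (P (nat_process M s @^-1` A `&`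
     [set w | B (nat_process M (s + h) w - nat_process M s w)%R]) =
   P (nat_process M s @^-1` A) * P (nat_process M h @^-1` B))%E.
Proof.
move=> s0 h0 mA mB.
(* Only the first three times count; the sequence then stays at [s + h] to be monotone on all of
   [nat]. *)
pose tt i : R := if i is i'.+1 then (if i' is _.+1 then s + h else s) else 0.
pose BB (i : 'I_2) := if i == 0 :> nat then A else B.
have tt_homo : {homo tt : i j / (i <= j)%N >-> i <= j}.
  by case=> [|[|i]] [|[|j]]//= _; rewrite ?addr_ge0// lerDl.
have mBB i : measurable (BB i) by rewrite /BB; case: ifP.
have := @levy_independent _ _ _ _ _ M_levy 2 tt (lexx 0) tt_homo BB mBB.
rewrite (big_ord_recl 1%N) big_ord1/= /BB/=.
have -> : (fun w => nat_process M s w - nat_process M 0 w) = nat_process M s.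
  by apply/funext => w; rewrite /nat_process M0 subr0.
rewrite -(levy_stationary M_levy s0 h0 mB) => <-; congr (P _).
apply/seteqP; split=> w /=.
  move=> [Aw Bw] [[|[|i]] ilt] _ //=.
  by rewrite /nat_process M0 subr0.
move=> BBw; split; last by have := BBw (@Ordinal 2 1 isT) I.
by have := BBw ord0 I; rewrite /= /nat_process M0 subr0.
Qed.

Lemma state_prob0 n : state_prob n 0 = (n == 0%N)%:R.
Proof.
rewrite /state_prob; case: eqVneq => [->|n0].
  rewrite (_ : [set _ | _] = setT) ?probability_setT//.
  by apply/seteqP; split=> w //= _; exact: M0.
rewrite (_ : [set _ | _] = set0) ?measure0//.
by apply/seteqP; split=> w //=; rewrite M0 => n0'; rewrite -n0' eqxx in n0.
Qed.

Lemma state_prob_ge0 n t : 0 <= state_prob n t.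
Proof. exact: fine_ge0. Qed.

Lemma state_prob_le1 n t : 0 <= t -> state_prob n t <= 1.
Proof.
move=> t0; rewrite -lee_fin fineK ?probability_le1//; first exact: measurable_state.
by apply: fin_num_measure; exact: measurable_state.
Qed.

Lemma state_probE n t : 0 <= t -> P [set w | M t w = n] = (state_prob n t)%:E.
Proof. by move=> t0; rewrite fineK// fin_num_measure//; exact: measurable_state. Qed.

(** * Convolution semigroup of the state probabilities *)

Lemma state_probD n s h : 0 <= s -> 0 <= h ->
  state_prob n (s + h) =
  \sum_(i < n.+1) state_prob (n - i) s * state_prob i h.
Proof.
move=> s0 h0; apply: EFin_inj; rewrite -state_probE ?addr_ge0//.
pose D w : R := nat_process M (s + h) w - nat_process M s w.
pose F i := [set w | M s w = (n - i)%N] `&` [set w | [set i%:R] (D w)].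
(* The event that the path goes down between [s] and [s + h]. It is null because the increment has
   the law of M(h), which is nonnegative, and it covers what M(s + h) = n leaves outside the [F i].
   The trivial condition [setT] on M(s) gives it the shape of [nat_process_increment]. *)
pose N := setT `&` [set w | `]-oo, 0[%classic (D w)].
have mD B : measurable B -> measurable [set w | B (D w)].
  move=> mB; rewrite -[X in measurable X]setTI.
  have mfD : measurable_fun setT D.
    by apply: measurable_funB; apply: (levy_measurable M_levy); rewrite ?addr_ge0.
  exact: mfD.
have mF i : measurable (F i).
  by apply: measurableI; [exact: measurable_state|exact: mD].
have PF i : P (F i) = (state_prob (n - i) s * state_prob i h)%:E.
  rewrite EFinM -!state_probE// /F !nat_process_preimage.
  by rewrite nat_process_increment.
have PN : P N = 0%E.
  rewrite /N -(preimage_setT (nat_process M s)) nat_process_increment//.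
  rewrite [X in (_ * P X)%E](_ : _ = set0) ?measure0 ?mule0//.
  by apply/seteqP; split => w //=; rewrite in_itv/= ltNge /nat_process ler0n.
rewrite -sumEFin; under eq_bigr do rewrite -PF.
have tF : trivIset setT F.
  move=> i j _ _ [w [[_ /= Di] [_ /= Dj]]]; apply/eqP.
  by rewrite -(eqr_nat R) -Di Dj.
rewrite -(measure_bigsetU P)//.
have mbigF : measurable (\big[setU/set0]_(i < n.+1) F i).
  exact: bigsetU_measurable.
have mN : measurable N by rewrite /N setTI; exact: mD.
have mn := measurable_state n _ (addr_ge0 s0 h0).
apply/eqP; rewrite eq_le; apply/andP; split.
  rewrite -[leRHS]adde0 -PN; apply: (le_trans _ (measureU2 _ mbigF mN)).
  apply: le_measure; [exact/mem_set|exact/mem_set/measurableU|].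
  move=> w /= Mw; case: (leqP (M s w) n) => Msn; last first.
    by right; split=> //=; rewrite in_itv/= /D /nat_process Mw subr_lt0 ltr_nat.
  left; rewrite -bigcup_mkord; exists (n - M s w)%N; first by rewrite /= ltnS leq_subr.
  by split; rewrite /= ?subKn// /D /nat_process Mw natrB.
apply: le_measure; [exact/mem_set|exact/mem_set|].
rewrite -bigcup_mkord => w [i /= ilt [/= Msw]]; rewrite /D /nat_process Msw => /eqP.
by rewrite subr_eq -natrD subnKC// eqr_nat => /eqP.
Qed.
(* The right derivative at 0 of [h |-> P (M h = j)]; jumps of size [j] have rate
   [lambda (j - 1)]. *)
Definition jump_rate j : R :=
  if j is j'.+1 then oapp lambda 0 (insub j') else - total_rate lambda.

(** * Infinitesimal behaviour at time 0 *)

Lemma jump_prob00 j h : jump_prob P M 0 0 j h = state_prob j h.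
Proof.
rewrite /jump_prob /cprob (_ : [set w | M 0 w = 0%N] = setT).
  by rewrite setIT probability_setT divr1 add0r.
by apply/seteqP; split=> w //= _; exact: M0.
Qed.

Lemma littleo_quotient_cvg (f : R -> R) (a : R) :
  (fun h => f h - a * h) =o_ (0^'+) (fun h => h) ->
  h^-1 * f h @[h --> 0^'+] --> a.
Proof.
move=> /eqoP fo; apply/cvgrPdist_le => e e0; near=> h.
have h0 : 0 < h by [].
have : `|f h - a * h| <= e * `|h| by near: h; exact: fo.
have -> : a - h^-1 * f h = - (h^-1 * (f h - a * h)) by field; rewrite gt_eqF.
rewrite normrN normrM gtr0_norm ?invr_gt0// ler_pdivrMl// => /le_trans; apply.
by rewrite gtr0_norm// mulrC.
Unshelve. all: by end_near. Qed.

(** Since M(0) = 0 surely, the conditional probabilities from state 0 at time 0 are the state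
    probabilities themselves. *)
Lemma state_prob_jump_rate j :
  h^-1 * (state_prob j h - (j == 0%N)%:R) @[h --> 0^'+] --> jump_rate j.
Proof.
have P0 : P [set w | M 0 w = 0%N] != 0%E.
  by rewrite state_probE// state_prob0 eqxx eqe oner_neq0.
apply: littleo_quotient_cvg; case: j => [|j] /=.
  have := gcp_stay M_gcp (lexx 0) P0.
  under eq_fun do rewrite jump_prob00.
  rewrite (_ : (fun h => state_prob 0 h - 1%:R - - _ * h) =
    fun h => state_prob 0 h - (1 - total_rate lambda * h))//.
  by apply/funext => h; ring.
(* [insub] succeeds when the size [j + 1] is at most [k]; larger sizes get the default rate 0, in
   agreement with [gcp_rare]. *)
case: insubP => [i _ <-|].
  have := gcp_jump M_gcp (lexx 0) P0 i.
  under eq_fun do rewrite jump_prob00.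
  by rewrite (_ : (fun h => state_prob i.+1 h - 0%:R - _ * h) =
    fun h => state_prob i.+1 h - lambda i * h)//; apply/funext => h; rewrite subr0.
rewrite -leqNgt => kj /=.
have := gcp_rare M_gcp (lexx 0) P0 (j := j.+1) kj.
under eq_fun do rewrite jump_prob00.
by rewrite (_ : (fun h => state_prob j.+1 h - 0%:R - 0 * h) =
  fun h => state_prob j.+1 h)//; apply/funext => h; rewrite mul0r !subr0.
Qed.

(** * Differentiability of the state probabilities *)

Definition state_prob_deriv n t : R :=
  \sum_(i < n.+1) state_prob (n - i) t * jump_rate i.

(** The Kronecker symbol absorbs [state_prob n t] into the term [i = 0] of the convolution, so that
    every bracket is of order [h]. *)
Lemma state_probB n t h : 0 <= t -> 0 <= h ->
  state_prob n (t + h) - state_prob n t =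
  \sum_(i < n.+1) state_prob (n - i) t * (state_prob i h - (i == 0%N :> nat)%:R).
Proof.
move=> t0 h0; rewrite state_probD//.
under [RHS]eq_bigr do rewrite mulrBr.
rewrite sumrB; congr (_ - _); rewrite (bigD1 ord0)//= subn0 mulr1 big1 ?addr0//.
by move=> i /negbTE i0; rewrite (_ : (i == 0%N :> nat) = false) ?mulr0.
Qed.

Lemma state_prob_right_deriv n t : 0 <= t ->
  h^-1 * (state_prob n (t + h) - state_prob n t) @[h --> 0^'+]
    --> state_prob_deriv n t.
Proof.
move=> t0.
apply: (@cvg_trans _ (\sum_(i < n.+1) state_prob (n - i) t *
    (h^-1 * (state_prob i h - (i == 0%N :> nat)%:R)) @[h --> 0^'+])).
  apply: near_eq_cvg; near=> h; have h0 : 0 < h by [].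
  rewrite state_probB ?(ltW h0)// mulr_sumr.
  by apply: eq_bigr => i _; rewrite mulrCA.
apply: cvg_big => [|i _]; first exact: add_continuous.
by apply: cvgMl_tmp; exact: state_prob_jump_rate.
Unshelve. all: by end_near. Qed.

Lemma state_prob_at_right0 n :
  state_prob n h @[h --> 0^'+] --> ((n == 0%N)%:R : R).
Proof.
have h0 : h @[h --> 0^'+] --> (0 : R) by exact: cvg_at_right_filter.
have H : ((n == 0%N)%:R : R) + h * (h^-1 * (state_prob n h - (n == 0%N)%:R))
    @[h --> 0^'+] --> ((n == 0%N)%:R : R) + 0 * jump_rate n.
  by apply: cvgD; [exact: cvg_cst|exact: cvgM h0 (state_prob_jump_rate n)].
rewrite mul0r addr0 in H; apply: cvg_trans H.
apply: near_eq_cvg; near=> h; have hgt0 : 0 < h by [].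
by rewrite mulVKf ?lt0r_neq0// subrKC.
Unshelve. all: by end_near. Qed.

(** As state probabilities lie in [0, 1], the difference between times [t - h] and [t] is at most
    [S h], which does not depend on [t] and tends to 0. *)
Lemma state_prob_left_continuous n t : 0 < t ->
  state_prob n (t - h) @[h --> 0^'+] --> state_prob n t.
Proof.
move=> t0.
pose S h : R := \sum_(i < n.+1) `|state_prob i h - (i == 0%N :> nat)%:R|.
have S0 : S h @[h --> 0^'+] --> \sum_(i < n.+1) (0 : R).
  apply: cvg_big => [|i _]; first exact: add_continuous.
  pose a : R := (i == 0%N :> nat)%:R.
  have H : `|state_prob i h - a| @[h --> 0^'+] --> `|a - a|.
    by apply: cvg_norm; apply: cvgB; [exact: state_prob_at_right0|exact: cvg_cst].
  by rewrite subrr normr0 in H.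
rewrite big1_eq in S0.
suff H : state_prob n t - state_prob n (t - h) @[h --> 0^'+] --> 0.
  have : state_prob n t - (state_prob n t - state_prob n (t - h)) @[h --> 0^'+]
      --> state_prob n t - 0.
    by apply: cvgB => //; exact: cvg_cst.
  by rewrite subr0; under eq_fun do rewrite subKr.
apply: norm_cvg0; apply: (squeeze_cvgr _ (cvg_cst 0) S0).
near=> h; rewrite normr_ge0/=.
have h0 : 0 < h by [].
have th : 0 <= t - h by rewrite subr_ge0; near: h; exact: nbhs_right_le.
have := state_probB n (t - h) h th (ltW h0); rewrite subrK => ->.
apply: le_trans (ler_norm_sum _ _ _) _; apply: ler_sum => i _.
by rewrite normrM ler_piMl// ger0_norm ?state_prob_ge0// state_prob_le1.
Unshelve. all: by end_near. Qed.

(** The increment starts from [t - h], so the coefficients of the convolution move with [h]; left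
    continuity gives their limits. *)
Lemma state_prob_left_deriv n t : 0 < t ->
  h^-1 * (state_prob n t - state_prob n (t - h)) @[h --> 0^'+]
    --> state_prob_deriv n t.
Proof.
move=> t0.
apply: (@cvg_trans _ (\sum_(i < n.+1) state_prob (n - i) (t - h) *
    (h^-1 * (state_prob i h - (i == 0%N :> nat)%:R)) @[h --> 0^'+])).
  apply: near_eq_cvg; near=> h; have h0 : 0 < h by [].
  have th : 0 <= t - h by rewrite subr_ge0; near: h; exact: nbhs_right_le.
  have := state_probB n (t - h) h th (ltW h0); rewrite subrK => ->; rewrite mulr_sumr.
  by apply: eq_bigr => i _; rewrite mulrCA.
apply: cvg_big => [|i _]; first exact: add_continuous.
by apply: cvgM; [exact: state_prob_left_continuous|exact: state_prob_jump_rate].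
Unshelve. all: by end_near. Qed.

Lemma is_derive_state_prob n t : 0 < t ->
  is_derive t 1 (state_prob n) (state_prob_deriv n t).
Proof.
move=> t0.
have H : h^-1 *: (state_prob n (h *: 1 + t) - state_prob n t) @[h --> 0^']
    --> state_prob_deriv n t.
  rewrite /GRing.scale/=; under eq_fun do rewrite mulr1 (addrC _ t).
  apply: (@cvg_at_right_left_dnbhs _ R^o).
    exact: (state_prob_right_deriv n t (ltW t0)).
  apply/cvg_at_leftNP; rewrite oppr0.
  rewrite (_ : _ \o _ = fun h => h^-1 * (state_prob n t - state_prob n (t - h))).
    exact: state_prob_left_deriv.
  by apply/funext => h /=; rewrite invrN mulNr -mulrN opprB.
by apply: DeriveDef; [apply/cvg_ex; eexists; exact: H|apply/cvg_lim].
Qed.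

(** * Solution of the Kolmogorov system *)

Lemma sum_jump_rate (G : nat -> R) n :
  \sum_(i < n) G i * jump_rate i.+1 = \sum_(j < k | (j < n)%N) lambda j * G j.
Proof.
pose ext i : R := oapp lambda 0 (insub i).
have -> : \sum_(j < k | (j < n)%N) lambda j * G j =
          \sum_(j < k | (j < n)%N) ext j * G j.
  by apply: eq_bigr => j _; rewrite /ext valK.
(* Both sums are widened to indices below [k + n]; sizes above [k] contribute 0, the default value
   of [jump_rate]. *)
rewrite (big_ord_widen (k + n) (fun i => G i * jump_rate i.+1)) ?leq_addl//.
rewrite (big_ord_widen_cond (k + n) (fun i => i < n)%N (fun i => ext i * G i))
  ?leq_addr//.
rewrite [RHS]big_mkcondr; apply: eq_bigr => i _; case: ltnP => [_|ki].
  by rewrite mulrC.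
by rewrite /jump_rate insubF ?mulr0// ltnNge ki.
Qed.

Lemma state_prob_derivE n t : state_prob_deriv n t =
  - total_rate lambda * state_prob n t +
  \sum_(j < k | (j < n)%N) lambda j * state_prob (n - j.+1) t.
Proof.
rewrite /state_prob_deriv big_ord_recl/= subn0 mulrC; congr (_ + _).
by rewrite -(sum_jump_rate (fun j => state_prob (n - j.+1) t)).
Qed.

(** Strong induction on [n] with the integrating factor exp (Lambda u): by the induction hypothesis
    for smaller states, [f] has zero derivative at positive times, and it vanishes at 0. *)
Lemma state_prob_jump_poly n t : 0 <= t ->
  state_prob n t = expR (- (total_rate lambda * t)) * jump_poly lambda n t.
Proof.
set L := total_rate lambda.
elim/ltn_ind: n t => n ih t; rewrite le_eqVlt => /predU1P[<-|t0].
  by rewrite state_prob0 jump_poly0 mulr0 oppr0 expR0 mul1r.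
pose f u := expR (L * u) * state_prob n u - jump_poly lambda n u.
have fd (u : R) : 0 < u -> is_derive u 1 f 0.
  move=> u0.
  have dE : is_derive u 1 (fun u => expR (L * u)) (L * expR (L * u)).
    have := is_derive1_comp (is_derive_expR (L * u))
      (is_deriveZ L (is_derive_id u (1 : R))).
    by rewrite /GRing.scale/= mulr1 mulrC.
  have := is_deriveB (is_deriveM dE (is_derive_state_prob n u u0))
    (is_derive_jump_poly lambda n u).
  rewrite /GRing.scale/= state_prob_derivE.
  suff -> : \sum_(j < k | (j < n)%N) lambda j * state_prob (n - j.+1) u =
      expR (- (L * u)) *
      \sum_(j < k | (j < n)%N) lambda j * jump_poly lambda (n - j.+1) u.
    rewrite expRN -/L => h; apply: (is_derive_eq h); field.
    by rewrite gt_eqF// expR_gt0.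
  rewrite mulr_sumr; apply: eq_bigr => j jn; rewrite mulrCA ih ?ltW//.
  by rewrite ltn_subrL// (leq_ltn_trans _ jn).
have fc (u : R) : 0 < u -> {for u, continuous f}.
  by move=> /fd [df _]; exact/differentiable_continuous/derivable1_diffP.
have ft : {within `[0, t], continuous f}.
  apply/(continuous_within_itvP _ t0); split.
  - by move=> u; rewrite in_itv/= => /andP[u0 _]; exact: fc.
  - apply: cvgB.
      apply: cvgM; last by rewrite state_prob0; exact: state_prob_at_right0.
      apply: cvg_at_right_filter; apply: continuous_comp; last exact: continuous_expR.
      by apply: cvgM; [exact: cvg_cst|exact: cvg_id].
    apply: cvg_at_right_filter; apply/differentiable_continuous/derivable1_diffP.
    by have [] := is_derive_jump_poly lambda n 0.
  - exact/cvg_at_left_filter/fc.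
have fd' (u : R) : u \in `]0, t[ -> is_derive u 1 f 0.
  by rewrite in_itv/= => /andP[u0 _]; exact: fd.
have [u _] := MVT_segment (ltW t0) fd' ft.
rewrite mul0r {2}/f mulr0 expR0 mul1r state_prob0 jump_poly0 subrr subr0 => /eqP.
rewrite subr_eq0 => /eqP <-.
by rewrite mulrA -expRD addNr expR0 mul1r.
Qed.

End gcp_marginals.

(** * Scaling of the Gamma integral *)

Section gamma_scaling.
Context {R : realType}.
Notation leb := (@lebesgue_measure R).

Lemma preimage_mulr_itvoc (c a b : R) : 0 < c ->
  (fun x => c * x) @^-1` `]a, b] = `]c^-1 * a, c^-1 * b]%classic.
Proof.
move=> c0; apply/seteqP; split=> x /=; rewrite !in_itv/=.
  by rewrite ltr_pdivrMl// ler_pdivlMl.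
by rewrite ltr_pdivrMl// ler_pdivlMl.
Qed.

(** Lebesgue measure is [c] times its image under multiplication by [c], by uniqueness from the
    values on half-open intervals; the rest is integration against an image measure. *)
Lemma ge0_integral_mulr (c : R) (D : set R) (f : R -> \bar R) : 0 < c ->
  measurable D -> measurable_fun D f -> (forall x, D x -> (0 <= f x)%E) ->
  (\int[leb]_(x in D) f x =
   c%:E * \int[leb]_(x in (fun x => c * x)%R @^-1` D) f (c * x)%R)%E.
Proof.
move=> c0 mD mf f0.
pose mulc : measurableTypeR R -> measurableTypeR R := fun x => c * x.
have mmul : measurable_fun setT mulc by exact: mulrl_measurable.
pose mmul_pack : {mfun measurableTypeR R >-> measurableTypeR R} :=
  HB.pack mulc (isMeasurableFun.Build _ _ _ _ _ mmul).
pose cp := NngNum (ltW c0).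
have scaleE A : measurable A ->
    leb A = mscale cp (pushforward leb mmul_pack) A.
  apply: lebesgue_measure_unique => _ [[a b] _ <-].
  transitivity (c%:E * leb (mulc @^-1` `]a, b]))%E => //.
  have -> : mulc @^-1` `]a, b] = `]c^-1 * a, c^-1 * b]%classic.
    exact: preimage_mulr_itvoc.
  rewrite !lebesgue_measure_itv/=.
  rewrite !lte_fin ltr_pM2l ?invr_gt0//; case: ifP => _; last by rewrite mule0.
  by rewrite -!EFinD -EFinM -mulrBr mulVKf ?gt_eqF.
rewrite (@eq_measure_integral _ _ _ _ (mscale cp (pushforward leb mmul_pack)))//;
  last by move=> A mA _; exact: scaleE.
rewrite ge0_integral_mscale//= ge0_integral_pushforward//.
by move=> y /set_mem; exact: f0.
Qed.

(** Kept in the extended reals because convergence comes only later; when finite and [c > 0], it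
    equals Gamma(a) / c^a. *)
Definition gamma_integral (a c : R) : \bar R :=
  (\int[leb]_(x in `]0%R, +oo[) (x `^ (a - 1) * expR (- (c * x)))%:E)%E.

Lemma measurable_gamma_integrand (D : set R) (a c : R) : measurable D ->
  measurable_fun D (fun x : R => (x `^ (a - 1) * expR (- (c * x)))%:E).
Proof.
move=> mD; apply/measurable_EFinP/measurable_funM.
  apply: measurable_funTS; exact: measurable_powR.
apply: measurableT_comp => //; apply: measurableT_comp => //.
Qed.

Lemma gamma_integrand_ge0 (a c x : R) :
  (0 <= (x `^ (a - 1) * expR (- (c * x)))%:E)%E.
Proof. by rewrite lee_fin mulr_ge0 ?powR_ge0 ?expR_ge0. Qed.

Lemma gamma_integral_ge0 a c : (0 <= gamma_integral a c)%E.
Proof. by apply: integral_ge0 => x _; exact: gamma_integrand_ge0. Qed.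

Lemma gamma_integral1 a : Gamma a = fine (gamma_integral a 1).
Proof.
rewrite /Gamma /Rintegral /gamma_integral; congr fine.
by apply: eq_integral => x _; rewrite mul1r.
Qed.

(** Substitute [c * x] for [x]; the identity also covers infinite integrals. *)
Lemma gamma_integral_scale a c : 0 < c ->
  gamma_integral a 1 = ((c `^ a)%:E * gamma_integral a c)%E.
Proof.
move=> c0; rewrite {1}/gamma_integral (ge0_integral_mulr c)//; last 2 first.
- exact: measurable_gamma_integrand.
- by move=> x _; exact: gamma_integrand_ge0.
have -> : (fun x => c * x) @^-1` `]0, +oo[ = `]0%R, +oo[%classic.
  by apply/seteqP; split=> x /=; rewrite !in_itv/= !andbT pmulr_rgt0.
have -> : c `^ a = c * c `^ (a - 1).
  by rewrite -{2}(powRr1 (ltW c0)) -powRD ?subrKC// (gt_eqF c0) implybT.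
rewrite EFinM -muleA; congr (_ * _)%E; rewrite -ge0_integralZl_EFin ?powR_ge0//.
- apply: eq_integral => x /set_mem; rewrite /= in_itv/= andbT => x0.
  by rewrite -EFinM powRM ?(ltW c0) ?(ltW x0)// mul1r mulrA.
- by move=> x _; exact: gamma_integrand_ge0.
- exact: measurable_gamma_integrand.
Qed.

End gamma_scaling.

(** * Random time change *)

Section right_grid.
Context {R : realType}.
Implicit Types (m i : nat) (s : R).

(* The least multiple of [1 / (m + 1)] that is strictly larger than [s]: only the
   right limits of the paths of M are controlled. *)
Definition grid m s : R := (Num.truncn (s * m.+1%:R)).+1%:R / m.+1%:R.

Definition cell m i : set R := `[i%:R / m.+1%:R, i.+1%:R / m.+1%:R[%classic.

Lemma cellP m i s : cell m i s <-> 0 <= s /\ Num.truncn (s * m.+1%:R) = i.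
Proof.
have m0 : (0 : R) < m.+1%:R by [].
rewrite /cell /= in_itv/= ler_pdivrMr// ltr_pdivlMr//; split.
  move=> /andP[ilt sgt]; split.
    by rewrite -(pmulr_lge0 _ m0) (le_trans _ ilt).
  by apply: truncn_def; rewrite ilt.
move=> [s0 <-].
by apply: truncn_itv; rewrite mulr_ge0.
Qed.

Lemma cell_grid m i s : cell m i s -> grid m s = i.+1%:R / m.+1%:R.
Proof. by rewrite /grid => /cellP[_ ->]. Qed.

Lemma bigcup_cell m : \bigcup_i cell m i = `[0, +oo[%classic.
Proof.
apply/seteqP; split=> s /=; rewrite in_itv/= andbT.
  by move=> [i _ /cellP[]].
by move=> s0; exists (Num.truncn (s * m.+1%:R)) => //; apply/cellP.
Qed.

Lemma trivIset_cell m : trivIset setT (cell m).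
Proof.
by move=> i j _ _ [s [/cellP[_ <-] /cellP[_ <-]]].
Qed.

Lemma grid_gt m s : 0 <= s -> s < grid m s.
Proof.
move=> s0; rewrite /grid ltr_pdivlMr//.
by have /andP[] := truncn_itv (mulr_ge0 s0 (ler0n _ m.+1)).
Qed.

Lemma grid_ge0 m s : 0 <= grid m s.
Proof. by rewrite /grid divr_ge0. Qed.

Lemma grid_le m s : 0 <= s -> grid m s <= s + m.+1%:R^-1.
Proof.
move=> s0; rewrite /grid ler_pdivrMr// mulrDl mulVf// -natr1 lerD2r.
by have /andP[] := truncn_itv (mulr_ge0 s0 (ler0n _ m.+1)).
Qed.

Lemma grid_cvg s : 0 <= s -> grid ^~ s @ \oo --> s.
Proof.
move=> s0; have h : s + m.+1%:R^-1 @[m --> \oo] --> s + 0.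
  by apply: cvgD; [exact: cvg_cst|exact: cvg_harmonic].
rewrite addr0 in h; apply: (squeeze_cvgr _ (cvg_cst s) h).
by apply: nearW => m; rewrite (ltW (grid_gt _ _ s0)) grid_le.
Qed.

(** Grid points lie strictly to the right of [s], so a right limit suffices. *)
Lemma cvg_grid (g : R -> R) s : 0 <= s -> g @ s^'+ --> g s ->
  g (grid m s) @[m --> \oo] --> g s.
Proof.
move=> s0 /cvg_at_rightP; apply; split; last exact: grid_cvg.
by move=> m; exact: grid_gt.
Qed.

End right_grid.

(** * Law of a counting process at an independent random time *)

Section time_change.
Context {R : realType} {d : measure_display} {T : measurableType d}.
Variables (P : probability T R) (M : R -> T -> nat) (Y : T -> R) (n : nat).
Variables (G f : R -> R).
Notation leb := (@lebesgue_measure R).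
Notation pos := (`]0%R, +oo[%classic : set R).
Hypothesis mM : forall s, 0 <= s -> measurable [set w | M s w = n].
Hypothesis M_right : forall w s, 0 <= s ->
  nat_process M u w @[u --> s^'+] --> nat_process M s w.
Hypothesis mY : measurable_fun setT Y.
Hypothesis Y_ge0 : forall w, 0 <= Y w.
Hypothesis indep : forall s B, 0 <= s -> measurable B ->
  (P ([set w | M s w = n] `&` Y @^-1` B) =
   P [set w | M s w = n] * P (Y @^-1` B))%E.
Hypothesis PM : forall s, 0 <= s -> P [set w | M s w = n] = (G s)%:E.
Hypothesis G_right : forall s, 0 <= s -> G @ s^'+ --> G s.
Hypothesis mf : measurable_fun pos f.
Hypothesis f_ge0 : forall s, pos s -> 0 <= f s.
Hypothesis PY : forall B, measurable B ->
  P (Y @^-1` B) = (\int[leb]_(s in B `&` pos) (f s)%:E)%E.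

Let A m : set T := [set w | M (grid m (Y w)) w = n].

(** On this piece the discretized time is the constant [(i + 1) / (m + 1)], so independence at a
    fixed time applies. *)
Let F m i : set T := [set w | M (i.+1%:R / m.+1%:R) w = n] `&` Y @^-1` cell m i.

Let A_bigcup m : A m = \bigcup_i F m i.
Proof.
apply/seteqP; split=> w; rewrite /A /F /=; last first.
  by move=> [i _ [<- /cell_grid ->]].
move=> Mw; exists (Num.truncn (Y w * m.+1%:R)) => //; split=> //.
by apply/cellP.
Qed.

Let mYpre B : measurable B -> measurable (Y @^-1` B).
Proof. by move=> mB; rewrite -[X in measurable X]setTI; exact: mY. Qed.

Let mcell m i : measurable (cell m i : set R).
Proof. exact: measurable_itv. Qed.

Let mF m i : measurable (F m i).
Proof. by apply: measurableI; [exact/mM/divr_ge0|by apply: mYpre; exact: mcell]. Qed.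

Let mA m : measurable (A m).
Proof. by rewrite A_bigcup; apply: bigcup_measurable => i _; exact: mF. Qed.

Let tF m : trivIset setT (F m).
Proof.
move=> i j _ _ [w [[_ /= wi] [_ /= wj]]].
by apply: (trivIset_cell m i j I I); exists (Y w).
Qed.

Let D m i : set R := cell m i `&` pos.

Let bigcup_D m : \bigcup_i D m i = pos.
Proof.
rewrite -setI_bigcupl bigcup_cell; apply/setIidr => s /=.
by rewrite !in_itv/= !andbT; exact: ltW.
Qed.

Let mD m i : measurable (D m i).
Proof. by apply: measurableI; [exact: mcell|exact: measurable_itv]. Qed.

Let G_ge0 s : 0 <= s -> 0 <= G s.
Proof. by move=> s0; rewrite -lee_fin -PM. Qed.

Let G_le1 s : 0 <= s -> G s <= 1.
Proof. by move=> s0; rewrite -lee_fin -PM// probability_le1//; exact: mM. Qed.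

(** [G] composed with the grid is constant on each cell, hence measurable. *)
Let mGf m : measurable_fun pos (fun s => (G (grid m s) * f s)%:E).
Proof.
apply/measurable_EFinP; apply: measurable_funM => //.
rewrite -(bigcup_D m); apply/measurable_fun_bigcup => // i.
apply: (eq_measurable_fun (cst (G (i.+1%:R / m.+1%:R)))) => //.
by move=> s /set_mem[/cell_grid ->].
Qed.

(** Independence factors the probability of each [F m i]; the constant value of [G] on the cell then
    enters the integral of the density over that cell. *)
Let PA m : P (A m) = (\int[leb]_(s in pos) (G (grid m s) * f s)%:E)%E.
Proof.
rewrite A_bigcup measure_bigcup// (@eq_eseriesl _ _ xpredT) => [|i];
  last exact: in_setT.
rewrite -[in RHS](bigcup_D m) ge0_integral_bigcup//; last 3 first.
- by rewrite bigcup_D; exact: mGf.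
- move=> s; rewrite bigcup_D => s0.
  by rewrite lee_fin mulr_ge0 ?f_ge0 ?G_ge0 ?grid_ge0.
- by apply: trivIset_setIr; exact: trivIset_cell.
apply: eq_eseriesr => i _.
transitivity (P [set w | M (i.+1%:R / m.+1%:R) w = n] * P (Y @^-1` cell m i))%E.
  by apply: indep; [rewrite divr_ge0|exact: mcell].
rewrite PM ?divr_ge0// PY//.
rewrite -ge0_integralZl_EFin//; first last.
- by apply: G_ge0; rewrite divr_ge0.
- by apply/measurable_EFinP; apply: measurable_funS mf => //; exact: subIsetr.
- by move=> s [_ /f_ge0]; rewrite lee_fin.
- exact: mD.
  by apply: eq_integral => s /set_mem[/cell_grid -> _]; rewrite EFinM.
exact: mD.
Qed.

Let B : set T := [set w | M (Y w) w = n].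

Let A_cvg w : \1_(A m) w @[m --> \oo] --> (\1_B w : R).
Proof.
have := cvg_grid (fun u => nat_process M u w) (Y w) (Y_ge0 w) (M_right w _ (Y_ge0 w)).
(* Naturals at distance less than 1 are equal, so M at the grid time eventually equals M at
   [Y w]. *)
move=> /cvgrPdist_lt/(_ _ ltr01) h.
apply: cvg_near_cst; near=> m.
have : `|nat_process M (Y w) w - nat_process M (grid m (Y w)) w| < 1.
  by near: m; exact: h.
rewrite /nat_process => MM.
have {}MM : M (Y w) w = M (grid m (Y w)) w.
  move: MM; rewrite ltr_norml ltrBrDr ltrBlDr addrC ltrBlDr natr1 nat1r !ltr_nat !ltnS.
  by move=> MM; apply/eqP; rewrite eqn_leq andbC.
by rewrite !indicE; congr (nat_of_bool _)%:R; apply/idP/idP => /set_mem h';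
  apply/mem_set; rewrite /A /B /= in h' *; congruence.
Unshelve. all: by end_near. Qed.

(** The indicator is the pointwise limit of the indicators of the [A m], each a countable union of
    measurable pieces. *)
Lemma measurable_time_change : measurable [set w | M (Y w) w = n].
Proof.
apply/(measurable_indicP R);
apply: (@measurable_fun_cvg _ _ _ _ (fun m => \1_(A m))) => [m|w _].
  by apply: measurable_indic; exact: mA.
exact: A_cvg.
Qed.

(** Both sides of [PA] pass to the limit by dominated convergence, with bound 1 under [P] and bound
    [f] under Lebesgue measure. *)
Lemma time_change_law :
  P [set w | M (Y w) w = n] = (\int[leb]_(s in pos) (G s * f s)%:E)%E.
Proof.
have mpos : measurable pos by exact: measurable_itv.
have mB : measurable B := measurable_time_change.
have limA : P (A m) @[m --> \oo] --> P B.
  have intE C : measurable C -> P C = (\int[P]_w (\1_C w)%:E)%E.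
    by move=> mC; rewrite integral_indic// setIT.
  rewrite (intE B)//; under eq_fun do rewrite intE//.
  apply: (@dominated_cvg _ _ _ P setT measurableT _ _ (cst 1%E)) => //.
  - by move=> m; apply/measurable_EFinP; apply: measurable_indic; exact: mA.
  - by move=> w _; apply: cvg_EFin; [exact: nearW|exact: A_cvg].
  - by apply: finite_measure_integrable_cst.
  - by move=> m w _; rewrite lee_fin ger0_norm// indicE lern1 leq_b1.
have limG : (\int[leb]_(s in pos) (G (grid m s) * f s)%:E)%E @[m --> \oo] -->
    (\int[leb]_(s in pos) (G s * f s)%:E)%E.
  apply: (@dominated_cvg _ _ _ leb pos mpos _ _ (fun s => (f s)%:E)) => //.
  - move=> s s0; apply: cvg_EFin; first exact: nearW.
    apply: cvgMr_tmp; apply: cvg_grid; last apply: G_right.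
      by move: s0; rewrite /= in_itv/= andbT; exact: ltW.
    by move: s0; rewrite /= in_itv/= andbT; exact: ltW.
  - apply/integrableP; split; first exact/measurable_EFinP.
    have f1 : (\int[leb]_(s in pos) (f s)%:E = 1)%E.
      by rewrite -(probability_setT P) -(preimage_setT Y) PY// setTI.
    have -> : (\int[leb]_(s in pos) `|(f s)%:E| = \int[leb]_(s in pos) (f s)%:E)%E.
      by apply: eq_integral => s /set_mem s0; rewrite gee0_abs// lee_fin f_ge0.
    by rewrite f1 ltry.
  - move=> m s s0; rewrite lee_fin normrM !ger0_norm ?G_ge0 ?grid_ge0 ?f_ge0//.
    by rewrite ler_piMl ?f_ge0 ?G_le1 ?grid_ge0.
apply: (cvg_unique _ limA); first exact: ereal_hausdorff.
by apply: cvg_trans limG; apply: near_eq_cvg; apply: nearW => m; rewrite -PA.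
Qed.

End time_change.

(** * Mixing over the squared Bessel law *)

Section besq_marginal.
Context {R : realType}.
Notation leb := (@lebesgue_measure R).

Lemma Gamma_ge0 (a : R) : 0 <= Gamma a.
Proof. by rewrite gamma_integral1 fine_ge0// gamma_integral_ge0. Qed.

Lemma besq0_density_ge0 (gamma s t : R) : 0 <= besq0_density gamma s t.
Proof.
by rewrite /besq0_density divr_ge0 ?mulr_ge0 ?expR_ge0 ?powR_ge0 ?Gamma_ge0.
Qed.

Lemma measurable_besq0_density (D : set R) (gamma t : R) : measurable D ->
  measurable_fun D (fun s => besq0_density gamma s t).
Proof.
move=> mD; rewrite (_ : (fun s => _) = fun s =>
    s `^ (gamma / 2 - 1) * expR (- ((2 * t)^-1 * s)) *
    ((2 * t) `^ (gamma / 2) * Gamma (gamma / 2))^-1); last first.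
  by apply/funext => s; rewrite /besq0_density (mulrC s) [expR _ * _]mulrC.
apply: measurable_funM => //.
by apply/measurable_EFinP; exact: measurable_gamma_integrand.
Qed.

Lemma nneseries_only0 (u : nat -> \bar R) : (0 <= u 0%N)%E ->
  (forall m, u m.+1 = 0%E) -> (\sum_(0 <= m <oo) u m)%E = u 0%N.
Proof.
move=> u0 uS; rewrite (nneseries_split 0 1)//= => [|m _]; last first.
  by case: m => // m; rewrite uS.
rewrite big_nat1 [X in (_ + X)%E]eseries0 ?adde0//.
by case=> // m _ _; rewrite uS.
Qed.

(** Starting from 0, all Poisson weights vanish except the one at [m = 0], where 0^0 = 1. *)
Lemma besq_density0 (gamma t y : R) :
  besq_density gamma t 0 y = (besq0_density gamma y t)%:E.
Proof.
rewrite /besq_density nneseries_only0.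
- by rewrite mul0r oppr0 expR0 expr0 fact0 divr1 !mul1r muln0 addr0.
- rewrite lee_fin mulr_ge0 ?besq0_density_ge0// divr_ge0// mulr_ge0 ?expR_ge0//.
- by move=> m; rewrite mul0r exprS !mul0r mulr0 !mul0r.
Qed.

Context {d : measure_display} {T : measurableType d}.
Variables (P : probability T R) (gamma : R) (Y : R -> T -> R).
Hypothesis Y_besq : squared_bessel0 P gamma Y.

Lemma besq_marginal t B : 0 < t -> measurable B ->
  P (Y t @^-1` B) =
  (\int[leb]_(s in B `&` `]0%R, +oo[) (besq0_density gamma s t)%:E)%E.
Proof.
move=> t0 mB.
have := @besq_fddE _ _ _ _ _ _ Y_besq [:: t] (fun=> B).
rewrite /= andbT => /(_ t0 (fun=> mB)).
rewrite (_ : \bigcap_(s in _) _ = Y t @^-1` B) => [->|].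
  by apply: eq_integral => y _; rewrite mule1 subr0 besq_density0.
apply/seteqP; split=> w /= => [|Yw s].
  by apply; rewrite /= mem_seq1.
by rewrite /= mem_seq1 => /eqP ->.
Qed.

End besq_marginal.

(** * Mixture of the state probabilities over a Gamma density *)

Section subordination.
Context {R : realType} {k : nat} (lambda : 'I_k -> R).
Variables (gamma t : R).
Hypotheses (lambda_gt0 : forall j, 0 < lambda j) (t_gt0 : 0 < t).
Notation leb := (@lebesgue_measure R).
Notation pos := (`]0%R, +oo[%classic : set R).
Hypothesis mass1 : (\int[leb]_(s in pos) (besq0_density gamma s t)%:E = 1)%E.

Let L := total_rate lambda.
Let K := (2 * t) `^ (gamma / 2) * Gamma (gamma / 2).
(** The rate of the product of exp (- L s) and exp (- s / 2t). *)
Let c := L + (2 * t)^-1.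

Lemma weight_gt0 x : 0 < weight lambda x.
Proof.
apply: prodr_gt0 => j _; by rewrite divr_gt0 ?exprn_gt0// ltr0n fact_gt0.
Qed.

(** If [K] were 0, the convention that 0 has inverse 0 would make the density vanish, against its
    total mass 1. *)
Let K_gt0 : 0 < K.
Proof.
rewrite lt_neqAle mulr_ge0 ?powR_ge0 ?Gamma_ge0// andbT.
apply/eqP => K0; move: mass1; rewrite integral0_eq => [/eqP|s _].
  by rewrite eq_sym onee_eq0.
by rewrite /besq0_density -/K -K0 invr0 mulr0.
Qed.

Let c_gt0 : 0 < c.
Proof.
rewrite ltr_wpDl ?invr_gt0 ?mulr_gt0//.
by apply: sumr_ge0 => j _; exact: ltW.
Qed.

Lemma mixed_density n s : 0 < s ->
  expR (- (L * s)) * jump_poly lambda n s * besq0_density gamma s t =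
  \sum_(x \in Omega k n) weight lambda x / K *
    (s `^ ((nb_jumps x)%:R + gamma / 2 - 1) * expR (- (c * s))).
Proof.
move=> s0; rewrite /jump_poly mulrAC mulr_fsumr; apply: eq_fsbigr => x _.
rewrite /besq0_density -/K -addrA [in RHS]powRD; last by rewrite (gt_eqF s0) implybT.
have -> : - (c * s) = - (L * s) + - (s / (2 * t)).
  by rewrite /c; field; rewrite gt_eqF.
by rewrite expRD powR_mulrn ?(ltW s0)//; ring.
Qed.

Lemma mixed_integral n :
  (\int[leb]_(s in pos)
     (expR (- (L * s)) * jump_poly lambda n s * besq0_density gamma s t)%:E =
   \sum_(x \in Omega k n) (weight lambda x / K)%:E *
     gamma_integral ((nb_jumps x)%:R + gamma / 2) c)%E.
Proof.
have fO := finite_Omega (k := k) n.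
pose g (x : {ffun 'I_k -> nat}) (s : R) : \bar R :=
  (s `^ ((nb_jumps x)%:R + gamma / 2 - 1) * expR (- (c * s)))%:E.
have wK x : 0 <= weight lambda x / K by rewrite divr_ge0 ?ltW// weight_gt0.
transitivity (\int[leb]_(s in pos)
    (\sum_(x \in Omega k n) ((weight lambda x / K)%:E * g x s)))%E.
  apply: eq_integral => s /set_mem; rewrite /= in_itv/= andbT => s0.
  by rewrite mixed_density// -fsumEFin.
rewrite ge0_integral_fsum//.
- apply: eq_fsbigr => x _; rewrite ge0_integralZl_EFin//.
  + by move=> s _; exact: gamma_integrand_ge0.
  + exact: measurable_gamma_integrand.
- by move=> x; apply: measurable_funeM; exact: measurable_gamma_integrand.
- by move=> x s _; apply: mule_ge0; [rewrite lee_fin|exact: gamma_integrand_ge0].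
Qed.

(** In a finite sum of nonnegative terms with positive coefficients, finiteness of the sum passes to
    each Gamma integral, so the [fine] inside [Gamma] loses nothing. *)
Lemma mixed_sum n :
  (\sum_(x \in Omega k n) (weight lambda x / K)%:E *
     gamma_integral ((nb_jumps x)%:R + gamma / 2) c < +oo ->
   \sum_(x \in Omega k n) (weight lambda x / K)%:E *
     gamma_integral ((nb_jumps x)%:R + gamma / 2) c =
   (\sum_(x \in Omega k n)
     weight lambda x *
     ((2 * t) ^+ nb_jumps x * Gamma ((nb_jumps x)%:R + gamma / 2) /
      (Gamma (gamma / 2) *
       (2 * L * t + 1) `^ ((nb_jumps x)%:R + gamma / 2))))%:E)%E.
Proof.
have fO := finite_Omega (k := k) n.
move=> fin; rewrite -fsumEFin//; apply: eq_fsbigr => x /set_mem xO.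
set z := nb_jumps x; set a := z%:R + gamma / 2.
have wK y : 0 < weight lambda y / K by rewrite divr_gt0 ?weight_gt0.
have gi_fin : gamma_integral a c \is a fin_num.
  have term_fin : ((weight lambda x / K)%:E * gamma_integral a c < +oo)%E.
    apply: le_lt_trans fin; rewrite [leRHS](fsbigD1 x)//= leeDl// fsume_ge0// => y _.
    by apply: mule_ge0; [rewrite lee_fin ltW|exact: gamma_integral_ge0].
  rewrite ge0_fin_numE ?gamma_integral_ge0// ltey.
  by apply: contraTneq term_fin => ->; rewrite gt0_muley ?lte_fin// ltxx.
have a_scale := gamma_integral_scale a c c_gt0.
have GammaE : Gamma a = c `^ a * fine (gamma_integral a c).
  by rewrite gamma_integral1 a_scale -(fineK gi_fin).
rewrite -(fineK gi_fin) -EFinM; congr EFin.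
have t2 : 0 < 2 * t by rewrite mulr_gt0.
have t2a : (2 * t) `^ a = (2 * t) ^+ z * (2 * t) `^ (gamma / 2).
  by rewrite powRD ?(gt_eqF t2) ?implybT// powR_mulrn// ltW.
(* This is the factorization 2Lt + 1 = c (2t), which produces the denominator of the formula. *)
have ca : (2 * L * t + 1) `^ a = c `^ a * (2 * t) `^ a.
  rewrite -powRM ?ltW//; congr (_ `^ _); rewrite /c; field.
  by rewrite gt_eqF.
rewrite ca t2a GammaE /K.
have G0 : Gamma (gamma / 2) != 0.
  by move: K_gt0; rewrite /K; apply: contraTneq => ->; rewrite mulr0 ltxx.
field; rewrite G0 !gt_eqF ?powR_gt0 ?exprn_gt0//.
Qed.

End subordination.

(** * State probabilities of the time-changed process *)

Theorem proposition4p2 (R : realType) (d : measure_display)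
  (T : measurableType d) (P : probability T R)
  (k : nat) (lambda : 'I_k -> R) (gamma : R)
  (M : R -> T -> nat) (X : R -> T -> R)
  (k_ge1 : (1 <= k)%N)
  (lambda_gt0 : forall j, 0 < lambda j)
  (gamma_gt0 : 0 < gamma)
  (M_gcp : gcp P lambda M)
  (X_bessel : bessel0 P gamma X)
  (M_X_indep : independent_processes P (nat_process M) X) :
  forall (n : nat) (t : R), 0 < t ->
  P [set w | time_changed M (fun s v => X s v ^+ 2) t w = n] =
  (\sum_(x \in Omega k n)
     let z := (\sum_(j < k) x j)%N in
     (\prod_(j < k) (lambda j ^+ x j / (x j)`!%:R)) *
     ((2 * t) ^+ z * Gamma (z%:R + gamma / 2) /
      (Gamma (gamma / 2) *
       (2 * total_rate lambda * t + 1) `^ (z%:R + gamma / 2))))%:E.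
Proof.
move=> n t t0; rewrite /time_changed.
have X2 := bessel_square X_bessel.
pose Y w := X t w ^+ 2.
have mX : measurable_fun setT (X t).
  by apply: (bessel_measurable X_bessel); exact: ltW.
have mY : measurable_fun setT Y by exact: measurable_funX.
have PY B : measurable B -> P (Y @^-1` B) =
    (\int[lebesgue_measure]_(s in B `&` `]0%R, +oo[)
      (besq0_density gamma s t)%:E)%E.
  exact: (besq_marginal P gamma _ X2 t).
have mass1 : (\int[lebesgue_measure]_(s in `]0%R, +oo[)
    (besq0_density gamma s t)%:E = 1)%E.
  by rewrite -(probability_setT P) -(preimage_setT Y) PY// setTI.
have M_right w s : 0 <= s ->
    nat_process M u w @[u --> s^'+] --> nat_process M s w.
  by move=> s0; have [+ _] := levy_cadlag (gcp_levy M_gcp) w; apply.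
have Y_ge0 w : 0 <= Y w by rewrite sqr_ge0.
have law : P [set w | M (Y w) w = n] = (\int[lebesgue_measure]_(s in `]0%R, +oo[)
    (expR (- (total_rate lambda * s)) * jump_poly lambda n s *
     besq0_density gamma s t)%:E)%E.
  apply: (time_change_law P M Y n
    (fun s => expR (- (total_rate lambda * s)) * jump_poly lambda n s)) => //.
  - by move=> s s0; exact: (measurable_state P k lambda M M_gcp).
  - move=> s B s0 mB; apply: M_X_indep; apply: sub_gen_smallest.
      by exists s, [set n%:R]; split=> //; exact: nat_process_preimage.
    (* Independence is given for X, so an event on its square is read as an event on X through the
       preimage under squaring. *)
    exists t, ((fun x : R => x ^+ 2) @^-1` B); split=> //; first exact: ltW.
    by rewrite -[X in measurable X]setTI; exact: measurable_funX.
  - move=> s s0; rewrite (state_probE P k lambda M M_gcp)//.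
    by rewrite (state_prob_jump_poly P k lambda M M_gcp).
  - move=> s s0; apply: cvg_at_right_filter; apply: cvgM.
      apply: continuous_comp; last exact: continuous_expR.
      by apply: cvgN; apply: cvgM; [exact: cvg_cst|exact: cvg_id].
    apply/differentiable_continuous/derivable1_diffP.
    by have [] := is_derive_jump_poly lambda n s.
  - exact: measurable_besq0_density.
  - by move=> s _; exact: besq0_density_ge0.
rewrite [LHS]law mixed_integral// mixed_sum//.
(* The finiteness required by [mixed_sum]: the sum is traced back to the integral, hence to a
   probability. *)
rewrite -mixed_integral// -law; apply: (@le_lt_trans _ _ 1%E); last exact: ltry.
apply: probability_le1; apply: (measurable_time_change M Y n) => //.
- by move=> s s0; exact: (measurable_state P k lambda M M_gcp).
Qed.
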